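(* There exist constants $c>0$ and $n_0$ such that for every integer $n\ge n_0$ there is a sequence $(G_t)_{t\ge1}$ of connected graphs on a common vertex set $V$ with $|V|=n$ such that, for $\mathcal{P}=(P_{\mathrm{LS}}(G_t))_{t\ge1}$, the pull voting according to $\mathcal{P}$ satisfies $t_{\mathrm{cons}}(\mathcal{P})\ge 2^{cn}$.
   Context: For a connected graph $G$ on $V$ with at least two vertices, $P_{\mathrm{LS}}(G)$ is the transition matrix of the lazy simple random walk: $P_{\mathrm{LS}}(G)(u,u)=1/2$, $P_{\mathrm{LS}}(G)(u,v)=\frac{1}{2\deg(G,u)}$ if $v$ is a neighbour of $u$, and $0$ otherwise. Pull voting according to $\mathcal{P}=(P_t)_{t\ge1}$: each vertex $v\in V$ holds an opinion from a finite set $\Sigma\subseteq\{0,\dots,n-1\}$. At round $t\ge1$, simultaneously and independently, each vertex $u$ picks a vertex $v$ according to $P_t(u,\cdot)$ and replaces its opinion by the opinion that $v$ held at the beginning of the round. $\tau_{\mathrm{cons}}(\mathcal{P})$ is the first time at which all vertices hold the same opinion, and $t_{\mathrm{cons}}(\mathcal{P})=\mathbf{E}[\tau_{\mathrm{cons}}(\mathcal{P})]\in[0,\infty]$, taken for the worst-case initial opinion configuration. *)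

(* Defs.v *)
From HB Require Import structures.
From mathcomp Require Import all_boot all_order all_algebra.
From mathcomp Require Import all_classical all_reals all_analysis.

Set Implicit Arguments.
Unset Strict Implicit.
Unset Printing Implicit Defensive.

Import Order.TTheory GRing.Theory Num.Theory.
Local Open Scope classical_set_scope.
Local Open Scope ring_scope.

Record sgraph (V : finType) := SGraph {
  edge :> rel V;
  edge_sym : symmetric edge;
  edge_irrefl : irreflexive edge }.

Definition connected_graph (V : finType) (G : sgraph V) : Prop :=
  forall u v : V, connect G u v.

Definition deg (V : finType) (G : sgraph V) (u : V) : nat := #|[set v | G u v]%SET|.

Definition P_LS (R : realType) (V : finType) (G : sgraph V) (u v : V) : R :=
  if u == v then 2^-1
  else if G u v then (2 * (deg G u)%:R)^-1
  else 0.

Definition mutually_independent (R : realType) (d : measure_display)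
    (Omega : measurableType d) (Pr : probability Omega R)
    (I : choiceType) (D : set I) (V : finType) (Z : I -> Omega -> V) : Prop :=
  forall (J : seq I) (A : I -> set V),
    uniq J -> [set` J] `<=` D ->
    Pr (\bigcap_(i in [set` J]) (Z i @^-1` A i)) =
      (\prod_(i <- J) Pr (Z i @^-1` A i))%E.

(* The vertex [C t u] is the one picked by [u] at round [t >= 1]; the values
   at index [0] of [P] and [C] play no role. *)
Definition pull_choices (R : realType) (V : finType) (P : nat -> V -> V -> R)
    (d : measure_display) (Omega : measurableType d) (Pr : probability Omega R)
    (C : nat -> V -> Omega -> V) : Prop :=
  [/\ forall t u v, (1 <= t)%N -> measurable (C t u @^-1` [set v]),
      forall t u v, (1 <= t)%N -> Pr (C t u @^-1` [set v]) = (P t u v)%:E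
    & mutually_independent Pr [set tu : nat * V | (1 <= tu.1)%N]
        (fun tu => C tu.1 tu.2) ].

Fixpoint pull_voting (V Omega : Type) (S : Type) (C : nat -> V -> Omega -> V)
    (x0 : V -> S) (t : nat) (w : Omega) : V -> S :=
  if t is t'.+1 then fun u => pull_voting C x0 t' w (C t'.+1 u w) else x0.

Definition consensus (V S : Type) (x : V -> S) : Prop := forall u v, x u = x v.

(* The infimum of the empty set is [+oo]: no consensus is ever reached. *)
Definition tau_cons (R : realType) (V Omega : Type) (S : Type)
    (C : nat -> V -> Omega -> V) (x0 : V -> S) (w : Omega) : \bar R :=
  ereal_inf [set (t%:R)%:E | t in [set t | consensus (pull_voting C x0 t w)]].

(* Worst case over all initial configurations with opinions in {0, ..., n-1},
   where n = #|V|; this covers every opinion set included in {0, ..., n-1}. *)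
Definition t_cons (R : realType) (V : finType)
    (d : measure_display) (Omega : measurableType d) (Pr : probability Omega R)
    (C : nat -> V -> Omega -> V) : \bar R :=
  ereal_sup (range (fun x0 : V -> 'I_#|V| =>
    (\int[Pr]_w tau_cons R C x0 w)%E)).

(* Main.v *)
(** Split the vertices into two halves and let [G_t] be a star on each half,
    with an edge joining the two hubs; the hubs change at every round, running
    cyclically through [m ~ n/2] vertices of their half.  Initially each half
    has its own opinion.  A vertex can import the opinion of the other half
    only while it is a hub; if it does, it is afterwards a leaf for [m - 1]
    rounds and, as long as the current hubs are right, is healed unless it is
    lazy in all of them.  Hence a hub is wrong when its turn comes only if it
    has been lazy for [m - 1] consecutive rounds, an event of probability
    [2^-(m-1)].  By a union bound the hubs of the two halves disagree
    throughout the first [2^(m-3)] rounds with probability at least 1/2. *)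
Require Import Defs.
From HB Require Import structures.
From mathcomp Require Import all_boot all_order all_algebra.
From mathcomp Require Import all_classical all_reals all_analysis.
From mathcomp Require Import measurable_realfun zify lra.
Import Order.TTheory GRing.Theory Num.Theory.
Local Open Scope ring_scope.

(** * Integral bounds for possibly non-measurable functions *)

Section Measure.
Local Open Scope classical_set_scope.
Local Open Scope ereal_scope.
Context {d : measure_display} {T : measurableType d} {R : realType}.

(* Stated without measurability because [tau_cons] is not known to be measurable. *)
Lemma ge0_le_integral_nonmeasurable (mu : {measure set T -> \bar R})
    (f g : T -> \bar R) :
  (forall x, 0 <= f x) -> (forall x, f x <= g x) ->
  \int[mu]_x f x <= \int[mu]_x g x.
Proof.
move=> f0 fg.
have g0 x : 0 <= g x by exact: le_trans (fg x).
rewrite !ge0_integralTE//; apply: ereal_sup_le.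
by move=> _ [h hf <-]; exists h => // x; exact: le_trans (fg x).
Qed.

(** Markov's inequality with no measurability of [g]: compare [g] with [a] times the indicator of
    [A]. *)
Lemma event_bound_le_integral (mu : {measure set T -> \bar R}) (A : set T) (a : R)
    (g : T -> \bar R) :
  measurable A -> (0 <= a)%R -> (forall x, 0 <= g x) ->
  (forall x, A x -> a%:E <= g x) -> a%:E * mu A <= \int[mu]_x g x.
Proof.
move=> mA a0 g0 ag.
have -> : a%:E * mu A = \int[mu]_x (a%:E * (\1_A x)%:E).
  rewrite ge0_integralZl_EFin//; last first.
    by apply/measurable_EFinP; exact: measurable_indic.
  by rewrite integral_indic// setIT.
apply: ge0_le_integral_nonmeasurable => x.
  by rewrite mule_ge0 // lee_fin.
rewrite indicE; have [/set_mem Ax|_] := boolP (x \in A).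
  by rewrite mule1; exact: ag.
by rewrite mule0.
Qed.

Lemma measure_bigsetU_le (mu : {measure set T -> \bar R}) (I : Type) (s : seq I)
    (F : I -> set T) :
  (forall i, measurable (F i)) ->
  mu (\big[setU/set0]_(i <- s) F i) <= \sum_(i <- s) mu (F i).
Proof.
move=> mF; elim: s => [|i s IH]; first by rewrite !big_nil measure0.
rewrite !big_cons; apply: le_trans (leeD2l _ IH).
by apply: measureU2 => //; exact: bigsetU_measurable.
Qed.

End Measure.

(** * Double stars with moving hubs *)

Section RollingDoubleStar.
Context {V : finType} (side : V -> bool) (hub : bool -> nat -> V) (m : nat).
Hypothesis side_hub : forall s t, side (hub s t) = s.
Hypothesis hub_inj : forall s t t', hub s t = hub s t' -> t = t' %[mod m].

Definition double_star_edge (t : nat) : rel V := fun u v =>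
  (u != v) &&
  (if side u == side v
   then (u == hub (side u) t) || (v == hub (side v) t)
   else (u == hub (side u) t) && (v == hub (side v) t)).

Lemma double_star_sym t : symmetric (double_star_edge t).
Proof.
move=> u v; rewrite /double_star_edge [v == u]eq_sym [side v == side u]eq_sym.
by rewrite [(v == _) || _]orbC [(v == _) && _]andbC.
Qed.

Lemma double_star_irrefl t : irreflexive (double_star_edge t).
Proof. by move=> u; rewrite /double_star_edge eqxx. Qed.

Definition double_star (t : nat) : sgraph V :=
  SGraph (double_star_sym t) (double_star_irrefl t).

Lemma double_star_connected t : connected_graph (double_star t).
Proof.
have to_hub u : connect (double_star t) u (hub (side u) t).
  have [<-//|nu] := eqVneq u (hub (side u) t).
  by apply: connect1; rewrite /= /double_star_edge nu !side_hub !eqxx orbT.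
have hubs s s' : connect (double_star t) (hub s t) (hub s' t).
  have [->//|ns] := eqVneq s s'.
  apply: connect1; rewrite /= /double_star_edge !side_hub (negPf ns) !eqxx !andbT.
  by apply: contra ns => /eqP/(congr1 side); rewrite !side_hub => ->.
move=> u v; apply: connect_trans (to_hub u) _.
apply: connect_trans (hubs _ (side v)) _.
by rewrite sym_connect_sym//; exact: double_star_sym.
Qed.

(** * Deterministic analysis of one outcome [w] *)

Section Trajectory.
Context {Omega S : Type} (C : nat -> V -> Omega -> V) (w : Omega) (T : nat).
Context (f : bool -> S).
Hypothesis C_nbr : forall t u, (0 < t <= T)%N ->
  C t u w = u \/ double_star t u (C t u w).
Hypothesis hub_moves : forall s k, (0 < k <= T)%N ->
  exists r, (k < r < k + m)%N /\ C r (hub s k) w <> hub s k.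

Local Notation opinion t := (pull_voting C (fun v => f (side v)) t w).

(** Invariant of wrong vertices. At [k = t] the laziness clause is vacuous: a hub may just have
    imported the other opinion. *)
Definition lazy_since_hub t v := exists k,
  [/\ (0 < k <= t)%N, hub (side v) k = v &
    forall r, (k < r <= t)%N -> C r v w = v].

(** A wrong upcoming hub would have been lazy since an earlier turn [k]. By [hub_inj] that turn is
    at least [m] rounds back, so the move given by [hub_moves] falls in the lazy period. *)
Lemma next_hub_right t s : (t <= T)%N ->
  (forall v, opinion t v <> f (side v) -> lazy_since_hub t v) ->
  opinion t (hub s t.+1) = f s.
Proof.
move=> tT wrong_lazy; apply: contrapT => wrong.
have [|k [kt hk lazy]] := wrong_lazy (hub s t.+1); first by rewrite side_hub.
rewrite side_hub in hk.
have /eqP mk := hub_inj _ _ _ hk.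
have ltk : (k < t.+1)%N by lia.
have km : (k + m <= t.+1)%N.
  rewrite eq_sym eqn_mod_dvd ?(ltnW ltk)// in mk.
  by have := dvdn_leq _ mk; lia.
have [|r [kr nr]] := hub_moves s k; first by lia.
by apply: nr; rewrite hk; apply: lazy; lia.
Qed.

Lemma wrong_vertex_lazy_since_hub t v : (t <= T)%N ->
  opinion t v <> f (side v) -> lazy_since_hub t v.
Proof.
elim: t v => [|t IH] v tT; first by [].
have hub_right s : opinion t (hub s t.+1) = f s.
  by apply: next_hub_right => [|u]; [exact: ltnW | exact/IH/ltnW].
move=> /= wrong.
have [hv|nhv] := eqVneq (hub (side v) t.+1) v.
  by exists t.+1; split=> [|//|r]; lia.
(* A leaf that moves copies the hub of its own side, which is right by [hub_right]. *)
have Cv : C t.+1 v w = v.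
  case: (C_nbr t.+1 v) => //= /andP[_]; rewrite [v == _]eq_sym (negPf nhv)/=.
  case: eqP => // sE /eqP hC; case: wrong.
  by rewrite hC hub_right -sE.
have [|k [kt hk lazy]] := IH v (ltnW tT); first by rewrite -{1}Cv.
exists k; split=> //; first by lia.
move=> r kr; have [->//|nr] := eqVneq r t.+1.
by apply: lazy; lia.
Qed.

Lemma opinion_next_hub t s : (t <= T)%N -> opinion t (hub s t.+1) = f s.
Proof. by move=> tT; apply: next_hub_right => // v; exact: wrong_vertex_lazy_since_hub. Qed.

End Trajectory.

(** * Probability of the bad event *)

Section Bad.
Local Open Scope classical_set_scope.
Context {R : realType} {d : measure_display} {Omega : measurableType d}.
Context (Pr : probability Omega R) (C : nat -> V -> Omega -> V).
Hypothesis C_choices : pull_choices (fun t => P_LS R (double_star t)) Pr C.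

(** These events are null, but the trajectory analysis needs legal choices at every outcome, so they
    are excluded one by one. *)
Definition illegal_choice (t : nat) (u v : V) : set Omega :=
  if (v == u) || double_star t u v then set0 else C t u @^-1` [set v].

Definition lazy_hub (s : bool) (k : nat) : set Omega :=
  \bigcap_(ru in [set` [seq (r, hub s k) | r <- iota k.+1 m.-1]])
    (C ru.1 ru.2 @^-1` [set hub s k]).

Definition bad_event (T : nat) : set Omega :=
  \big[setU/set0]_(p <- enum {: 'I_T * V * V}) illegal_choice p.1.1.+1 p.1.2 p.2
  `|` \big[setU/set0]_(q <- enum {: bool * 'I_T}) lazy_hub q.1 q.2.+1.

Lemma measurable_illegal_choice t u v : (0 < t)%N -> measurable (illegal_choice t u v).
Proof.
move=> t0; rewrite /illegal_choice; case: ifP => // _.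
by case: C_choices => mC _ _; exact: mC.
Qed.

Lemma measurable_lazy_hub s k : measurable (lazy_hub s k).
Proof.
apply: fin_bigcap_measurable => //= _ /mapP[r + ->] /=.
rewrite mem_iota => /andP[kr _].
by case: C_choices => mC _ _; apply: mC; lia.
Qed.

Lemma measurable_bad_event T : measurable (bad_event T).
Proof.
apply: measurableU; apply: bigsetU_measurable => i _.
- exact: measurable_illegal_choice.
- exact: measurable_lazy_hub.
Qed.

Lemma illegal_choice_null t u v : (0 < t)%N -> Pr (illegal_choice t u v) = 0%E.
Proof.
move=> t0; rewrite /illegal_choice; case: ifPn => [_|]; first exact: measure0.
rewrite negb_or eq_sym => /andP[uv /negPf e].
case: C_choices => _ PrC _.
by rewrite PrC// /P_LS (negPf uv) e.
Qed.

Lemma lazy_hub_proba s k : Pr (lazy_hub s k) = ((2^-1) ^+ m.-1)%:E.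
Proof.
case: C_choices => _ PrC indep.
rewrite /lazy_hub (indep _ (fun=> [set hub s k])).
- rewrite big_map (eq_big_seq (fun=> (2^-1)%:E)).
    by rewrite prodEFin big_const_seq count_predT size_iota iter_mulr_1.
  move=> r; rewrite mem_iota => /andP[kr _] /=.
  by rewrite PrC/P_LS ?eqxx//; lia.
- by rewrite map_inj_uniq ?iota_uniq// => r r' [].
- move=> _ /mapP[r + ->] /=.
  by rewrite mem_iota => /andP[kr _]; lia.
Qed.

(** Union bound: the illegal choices are null, and there is one lazy run for each of the [2 * T]
    pairs of a side and a round. *)
Lemma bad_event_proba T : (Pr (bad_event T) <= ((2 * T)%:R * (2^-1) ^+ m.-1)%:E)%E.
Proof.
rewrite /bad_event; apply: le_trans (measureU2 _ _ _) _ => /=.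
- by apply: bigsetU_measurable => i _; exact: measurable_illegal_choice.
- by apply: bigsetU_measurable => i _; exact: measurable_lazy_hub.
rewrite -[leRHS]add0e; apply: leeD.
  apply: le_trans (measure_bigsetU_le _ _ _ _ _) _ => /=.
    by move=> i; exact: measurable_illegal_choice.
  by rewrite big1// => i _; exact: illegal_choice_null.
apply: le_trans (measure_bigsetU_le _ _ _ _ _) _ => /=.
  by move=> i; exact: measurable_lazy_hub.
under eq_bigr do rewrite lazy_hub_proba.
rewrite sumEFin big_const_seq count_predT -cardE card_prod card_bool card_ord.
by rewrite iter_addr_0 mulr_natl.
Qed.

(** Off the bad event, at every time [t < T] the hubs of round [t.+1] hold [f true] and
    [f false]. *)
Lemma good_event_tau_cons (S : Type) (f : bool -> S) (T : nat) (w : Omega) :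
  f true <> f false -> (~` bad_event T) w ->
  (T%:R%:E <= tau_cons R C (fun v => f (side v)) w)%E.
Proof.
rewrite /bad_event -!bigcup_seq setCU !setC_bigcup => fne [legal nlazy].
apply: le_ereal_inf_tmp => _ [t cons <-]; rewrite lee_fin ler_nat leqNgt.
apply/negP => tT; apply: fne.
have C_nbr r u : (0 < r <= T)%N -> C r u w = u \/ double_star r u (C r u w).
  case: r => // r /= rT.
  have := legal (Ordinal rT, u, C r.+1 u w); rewrite /= mem_enum /illegal_choice.
  by case: eqP => [|_]; [left | case: ifP => [|_ /(_ isT)[]]; [right|]].
have hub_moves s k : (0 < k <= T)%N ->
    exists r, (k < r < k + m)%N /\ C r (hub s k) w <> hub s k.
  case: k => // k /= kT.
  have := nlazy (s, Ordinal kT); rewrite /= mem_enum => /(_ isT).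
  rewrite /lazy_hub => /existsNP[[r u]] /not_implyP[/= /mapP[r' + [-> ->]] ne].
  by rewrite mem_iota => kr; exists r'; split => //; lia.
have right s := opinion_next_hub C w T f C_nbr hub_moves t s (ltnW tT).
by rewrite -(right true) -(right false); exact: cons.
Qed.

Lemma t_cons_ge (T : nat) : (2 <= #|V|)%N -> (4 * T <= 2 ^ m.-1)%N ->
  ((T%:R / 2)%:E <= t_cons Pr C)%E.
Proof.
move=> V2 Tm.
(* Two distinct opinions: the ranks of hubs on opposite sides. *)
pose f (s : bool) : 'I_#|V| := enum_rank (hub s 0).
have fne : f true <> f false.
  by move/enum_rank_inj/(congr1 side); rewrite !side_hub.
apply: le_trans (ereal_sup_ubound _); last by exists (fun v => f (side v)).
apply: (@le_trans _ _ (T%:R%:E * Pr (~` bad_event T))%E).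
  have mB := measurable_bad_event T.
  rewrite probability_setC// EFinM; apply: lee_wpmul2l; first by rewrite lee_fin.
  have Bfin : Pr (bad_event T) \is a fin_num by exact: fin_num_measure.
  have := bad_event_proba T; rewrite -(fineK Bfin) -EFinB !lee_fin.
  set b := fine _ => hb.
  (* Hence the good event has probability at least 1/2. *)
  have : (2 * T)%:R * (2^-1) ^+ m.-1 <= 2^-1 :> R.
    rewrite exprVn ler_pdivrMr ?exprn_gt0// mulrC ler_pdivlMr//.
    by rewrite -natrX -natrM ler_nat; lia.
  by lra.
apply: event_bound_le_integral => //.
- by apply: measurableC; exact: measurable_bad_event.
- by move=> w; apply: le_ereal_inf_tmp => _ [t _ <-]; rewrite lee_fin.
- by move=> w; exact: good_event_tau_cons.
Qed.

End Bad.
End RollingDoubleStar.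

(** * The two halves and the constants *)

Definition half_side (n : nat) (v : 'I_n.+1) : bool := (n.+1./2 <= v)%N.

(** If the number of vertices is odd, the upper half has an extra vertex that is never a hub. *)
Definition half_hub (n : nat) (s : bool) (t : nat) : 'I_n.+1 :=
  inord (s * n.+1./2 + t %% n.+1./2).

Lemma half_hub_val (n : nat) (s : bool) (t : nat) : (0 < n)%N ->
  half_hub n s t = (s * n.+1./2 + t %% n.+1./2)%N :> nat.
Proof.
move=> n0; rewrite inordK//.
have : (t %% n.+1./2 < n.+1./2)%N by rewrite ltn_mod; lia.
by case: s; lia.
Qed.

Theorem proposition1p9 (R : realType) :
  exists (c : R) (n0 : nat), 0 < c /\
    forall n : nat, (n0 <= n)%N ->
      exists (V : finType) (G : nat -> sgraph V),
        [/\ #|V| = n,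
            forall t : nat, (1 <= t)%N -> connected_graph (G t)
          & forall (d : measure_display) (Omega : measurableType d)
                   (Pr : probability Omega R) (C : nat -> V -> Omega -> V),
              pull_choices (fun t => P_LS R (G t)) Pr C ->
              ((2 `^ (c * n%:R))%:E <= t_cons Pr C)%E].
Proof.
(* With [N] vertices and [m] the integer part of [N / 2], the bound obtained is [2 ^ (m - 4)], and
   [N / 4 <= m - 4] once [N >= 18]. *)
exists 4^-1, 18%N; split=> // -[//|n] n18.
set m := n.+1./2.
have side_hub s t : half_side n (half_hub n s t) = s.
  rewrite /half_side half_hub_val; last by lia.
  have tm : (t %% m < m)%N by rewrite ltn_mod /m; lia.
  by case: s; rewrite -/m ?mul1n ?leq_addr// mul0n leqNgt tm.
have hub_inj s t t' : half_hub n s t = half_hub n s t' -> t = t' %[mod m].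
  by move/(congr1 val); rewrite /= !half_hub_val; [exact: addnI | lia..].
exists 'I_n.+1, (double_star (half_side n) (half_hub n)); split.
- exact: card_ord.
- by move=> t _; exact: double_star_connected.
move=> d Omega Pr C HC.
(* This [T] gives equality in [4 * T <= 2 ^ m.-1]. *)
have := t_cons_ge _ _ m side_hub hub_inj Pr C HC (2 ^ (m - 3)).
rewrite card_ord => bound; apply: le_trans (bound _ _); last 2 first.
- by lia.
- by rewrite -[4%N]/(2 ^ 2)%N -expnD leq_exp2l//; rewrite /m; lia.
have -> : (2 ^ (m - 3))%:R / 2 = 2 `^ (m - 4)%:R :> R.
  have -> : (m - 3 = (m - 4).+1)%N by rewrite /m; lia.
  by rewrite powR_mulrn// natrX exprSr mulfK.
rewrite lee_fin; apply: ler_powR; first by lra.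
rewrite mulrC ler_pdivrMr// -natrM ler_nat /m; lia.
Qed.
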